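(* Let $p,q>1$ be integers. The hypergraph $Q_{pq}^{F}$ with $F=F_{pq}^{\ast}$ is mengerian.
   Context: Let $P=\{p_1,\dots,p_p\}$, $P^{\ast}=\{p_1^{\ast},\dots,p_p^{\ast}\}$, $Q=\{q_1,\dots,q_q\}$, $Q^{\ast}=\{q_1^{\ast},\dots,q_q^{\ast}\}$ and $r,r^{\ast}$ be pairwise distinct elements, and let $V_{pq}=P\cup P^{\ast}\cup Q\cup Q^{\ast}\cup\{r,r^{\ast}\}$. The map $v\mapsto v^{\ast}$ is the involution exchanging $p_i\leftrightarrow p_i^{\ast}$, $q_i\leftrightarrow q_i^{\ast}$, $r\leftrightarrow r^{\ast}$; for $S\subseteq V_{pq}$, $S^{\ast}=\{v^{\ast}:v\in S\}$, and for a family $F$ of subsets, $F^{\ast}=\{f^{\ast}:f\in F\}$. Juxtaposition denotes union, e.g. $XYz=X\cup Y\cup\{z\}$. The hypergraph $Q_{pq}=(V_{pq},E_{pq})$ has as edges exactly the sets $P_1(P\setminus P_1)^{\ast}Qr$ and $(P\setminus P_1)P_1^{\ast}Q^{\ast}r$ for $\emptyset\ne P_1\subseteq P$, and $P(Q\setminus Q_1)Q_1^{\ast}r^{\ast}$ and $P^{\ast}Q_1(Q\setminus Q_1)^{\ast}r^{\ast}$ for $\emptyset\neq Q_1\subseteq Q$. Put $F_{pq}=\{PQr,\ P^{\ast}Q^{\ast}r,\ PQ^{\ast}r^{\ast},\ P^{\ast}Qr^{\ast}\}\subseteq E_{pq}$, and for $F\subseteq E_{pq}^{\ast}$ let $Q_{pq}^{F}=(V_{pq},E_{pq}\cup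 F)$. Let $A$ be the incidence matrix of a hypergraph $H$ (columns are the characteristic vectors of the edges, rows indexed by vertices). $H$ is mengerian (has the max-flow min-cut property) if for every non-negative integral vector $w$ indexed by the vertices, both linear programs in the LP-duality equation $\min\{\langle w,x\rangle : x\ge 0,\ xA\ge\mathbf{1}\}=\max\{\langle y,\mathbf{1}\rangle : y\ge 0,\ Ay\le w\}$ have integral optimum solutions. *)

(* Defs.v *)
From mathcomp Require Import all_boot all_order all_algebra.

Set Implicit Arguments.
Unset Strict Implicit.
Unset Printing Implicit Defensive.

Import Order.TTheory GRing.Theory Num.Theory.
Local Open Scope ring_scope.

Section Mengerian.

Variable R : archiRealFieldType.

(* [x] is a row vector and [y] a column vector, so that the products x A and
   A y can be taken literally; <w, x> is the single entry of x w. *)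

Definition cover_feasible m n (A : 'M[R]_(m, n)) (x : 'rV[R]_m) : Prop :=
  (forall i, 0 <= x 0 i) /\ (forall j, 1 <= (x *m A) 0 j).

Definition cover_value m (w : 'cV[R]_m) (x : 'rV[R]_m) : R := (x *m w) 0 0.

Definition cover_optimal m n (A : 'M[R]_(m, n)) (w : 'cV[R]_m) (x : 'rV[R]_m) :
    Prop :=
  cover_feasible A x /\
  (forall x', cover_feasible A x' -> cover_value w x <= cover_value w x').

Definition packing_feasible m n (A : 'M[R]_(m, n)) (w : 'cV[R]_m)
    (y : 'cV[R]_n) : Prop :=
  (forall j, 0 <= y j 0) /\ (forall i, (A *m y) i 0 <= w i 0).

Definition packing_value n (y : 'cV[R]_n) : R := \sum_j y j 0.

Definition packing_optimal m n (A : 'M[R]_(m, n)) (w : 'cV[R]_m)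
    (y : 'cV[R]_n) : Prop :=
  packing_feasible A w y /\
  (forall y', packing_feasible A w y' -> packing_value y' <= packing_value y).

(* A hypergraph is a finite vertex type [V] together with its edge set
   [E : {set {set V}}]. *)

Definition incidence (V : finType) (E : {set {set V}}) : 'M[R]_(#|V|, #|E|) :=
  \matrix_(i, j) (enum_val i \in (enum_val j : {set V}))%:R.

Definition mengerian (V : finType) (E : {set {set V}}) : Prop :=
  forall w : 'cV[R]_#|V|, w \is a mxOver Num.nat ->
    (exists2 x : 'rV[R]_#|V|,
       x \is a mxOver Num.int & cover_optimal (incidence E) w x) /\
    (exists2 y : 'cV[R]_#|E|,
       y \is a mxOver Num.int & packing_optimal (incidence E) w y).

End Mengerian.

Section Qpq.

Variables p q : nat.

(* The boolean tells whether the vertex is starred: p_i, q_i and r are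
   (inl (inl i), false), (inl (inr i), false) and (inr tt, false). *)
Definition vertex : finType := (('I_p + 'I_q + unit) * bool)%type.

Definition star (v : vertex) : vertex := (v.1, ~~ v.2).

Definition star_set (S : {set vertex}) : {set vertex} := star @: S.

Definition star_family (F : {set {set vertex}}) : {set {set vertex}} :=
  star_set @: F.

Definition Pset : {set vertex} :=
  [set ((inl (inl i), false) : vertex) | i : 'I_p].

Definition Qset : {set vertex} :=
  [set ((inl (inr i), false) : vertex) | i : 'I_q].

Definition rvert : vertex := (inr tt, false).

Definition Epq : {set {set vertex}} :=
  [set P1 :|: star_set (Pset :\: P1) :|: Qset :|: [set rvert]
     | P1 in powerset Pset & P1 != set0] :|:
  [set (Pset :\: P1) :|: star_set P1 :|: star_set Qset :|: [set rvert]
     | P1 in powerset Pset & P1 != set0] :|: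
  [set Pset :|: (Qset :\: Q1) :|: star_set Q1 :|: [set star rvert]
     | Q1 in powerset Qset & Q1 != set0] :|:
  [set star_set Pset :|: Q1 :|: star_set (Qset :\: Q1) :|: [set star rvert]
     | Q1 in powerset Qset & Q1 != set0].

Definition Fpq : {set {set vertex}} :=
  [set Pset :|: Qset :|: [set rvert];
       star_set Pset :|: star_set Qset :|: [set rvert];
       Pset :|: star_set Qset :|: [set star rvert];
       star_set Pset :|: Qset :|: [set star rvert]].

(* The edge set of Q_pq^F, meant for F \subset star_family Epq. *)
Definition QpqF (F : {set {set vertex}}) : {set {set vertex}} := Epq :|: F.

End Qpq.

(* Main.v *)
(* The edges of Q_pq^F with F = F_pq^* are the transversals of the pairs
   {v, v^*} that contain r and one of Q, Q^*, or r^* and one of P, P^*.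
   With a = min w(p_i), a' = min w(p_i^* ), b = min w(q_j), b' = min w(q_j^* )
   and M the least weight of a pair {p_i, p_i^*} or {q_j, q_j^*}, both optima
   equal min(M, min(w(r), b + b') + min(w(r^* ), a + a')).  The covers are read
   off this formula.  A packing need only satisfy marginal constraints: once the
   numbers of edges containing r and Q, r and Q^*, r^* and P, r^* and P^* are
   fixed, the multiplicity of each p_i among the edges through r, and of each
   q_j among those through r^*, can be chosen independently; the k-th edge of
   each kind then uses a vertex or its star according to whether k is below the
   prescribed multiplicity. *)

Require Import Defs.
From mathcomp Require Import all_boot all_order all_algebra.
From mathcomp Require Import zify.

Set Implicit Arguments.
Unset Strict Implicit.
Unset Printing Implicit Defensive.

Import Order.TTheory GRing.Theory Num.Theory.
Local Open Scope ring_scope.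

(** * Integral optima certified by weak duality *)

Section Duality.

Variable R : archiRealFieldType.

Lemma weak_duality m n (A : 'M[R]_(m, n)) (w : 'cV[R]_m) x y :
  cover_feasible A x -> packing_feasible A w y ->
  packing_value y <= cover_value w x.
Proof.
move=> [x_ge0 xA_ge1] [y_ge0 Ay_le].
apply: (@le_trans _ _ ((x *m A *m y) 0 0)).
  rewrite mxE; apply: ler_sum => j _.
  by rewrite -[leLHS]mul1r ler_wpM2r.
rewrite -mulmxA /cover_value !mxE; apply: ler_sum => i _.
exact: ler_wpM2l.
Qed.

(** Turns a matrix product with a multiplicity vector into a sum over the list whose multiplicities
    it records. *)
Lemma sum_count_mem (T : finType) (A : {pred T}) (s : seq T) (F : T -> R) :
  {subset s <= A} ->
  \sum_(i < #|A|) (count_mem (enum_val i) s)%:R * F (enum_val i)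
    = \sum_(v <- s) F v.
Proof.
move=> sA; rewrite -(big_enum_val (A := A)
  (fun v => (count_mem v s)%:R * F v)) /=.
elim: s sA => [|a s IHs] sA.
  by rewrite big_nil big1 // => v _; rewrite mul0r.
rewrite big_cons -IHs; last by move=> v vs; apply: sA; rewrite inE vs orbT.
under eq_bigr => v _ do rewrite /= natrD mulrDl.
rewrite big_split /=; congr (_ + _).
rewrite (bigD1 a) ?sA ?mem_head //= eqxx mul1r big1 ?addr0 // => v /andP[_ va].
by rewrite eq_sym (negPf va) mul0r.
Qed.

Lemma sum_indicator (T : Type) (a : pred T) (s : seq T) :
  \sum_(x <- s) (a x)%:R = (count a s)%:R :> R.
Proof. by rewrite -natr_sum -sum1_count [in RHS]big_mkcond. Qed.

(** The multiplicities in [C] and [s] form an integral cover and an integral packing. By weak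
    duality, the last inequality makes both optimal. Lists are used because a packing may repeat an
    edge. *)
Lemma mengerian_nat (V : finType) (E : {set {set V}}) :
  (forall W : V -> nat, exists (C : seq V) (s : seq {set V}),
    [/\ forall e : {set V}, e \in E -> has (mem e) C,
        {subset s <= E},
        forall v, (count (fun e : {set V} => v \in e) s <= W v)%N
      & (\sum_(v <- C) W v <= size s)%N]) ->
  mengerian R E.
Proof.
move=> minmax w w_nat.
pose W v := Num.truncn (w (enum_rank v) 0).
have wE i : w i 0 = (W (enum_val i))%:R.
  by rewrite /W enum_valK truncnK //; apply/mxOverP.
have [C [s [C_cover sE s_pack le_Cs]]] := minmax W.
pose x : 'rV[R]_#|V| := \row_i (count_mem (enum_val i) C)%:R.
pose y : 'cV[R]_#|E| := \col_j (count_mem (enum_val j) s)%:R.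
have sumC (F : V -> R) :
    \sum_(i < #|V|) x 0 i * F (enum_val i) = \sum_(v <- C) F v.
  rewrite -(@sum_count_mem _ V) //.
  by apply: eq_bigr => i _; rewrite mxE.
have sums (F : {set V} -> R) :
    \sum_(j < #|E|) F (enum_val j) * y j 0 = \sum_(e <- s) F e.
  rewrite -(sum_count_mem F sE); apply: eq_bigr => j _.
  by rewrite mxE mulrC.
have x_feas : cover_feasible (incidence R E) x.
  split=> [i|j]; first by rewrite mxE ler0n.
  rewrite mxE; under eq_bigr => i _ do rewrite [incidence _ _ _ _]mxE.
  rewrite (sumC (fun v => (v \in (enum_val j : {set V}))%:R)) sum_indicator.
  by rewrite (ler_nat _ 1) -has_count C_cover ?enum_valP.
have y_feas : packing_feasible (incidence R E) w y.
  split=> [j|i]; first by rewrite mxE ler0n.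
  rewrite mxE; under eq_bigr => j _ do rewrite [incidence _ _ _ _]mxE.
  rewrite (sums (fun e => (enum_val i \in e)%:R)) sum_indicator wE ler_nat.
  exact: s_pack.
have le_xy : cover_value w x <= packing_value y.
  have -> : cover_value w x = (\sum_(v <- C) W v)%:R.
    rewrite natr_sum -sumC /cover_value mxE.
    by apply: eq_bigr => i _; rewrite wE.
  have -> : packing_value y = (size s)%:R.
    rewrite -sum1_size natr_sum -sums.
    by apply: eq_bigr => j _; rewrite mul1r.
  by rewrite ler_nat.
split; [exists x | exists y].
- by apply/mxOverP => i j; rewrite mxE natr_int.
- by split=> // x' /weak_duality/(_ y_feas); apply: le_trans.
- by apply/mxOverP => i j; rewrite mxE natr_int.
- by split=> // y' /(weak_duality x_feas)/le_trans; apply.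
Qed.

End Duality.

(** * Edges as transversals of the pairs of a vertex and its star *)

Section Transversals.

Variables p q : nat.

Implicit Types (f : 'I_p + 'I_q + unit -> bool) (S : {set vertex p q}).

Definition transversal f : {set vertex p q} := [set v | v.2 == f v.1].

(** The value [true] selects the starred vertex: an edge through r* lies wholly in P or wholly in P*
    on the p-side, and an edge through r does so with Q or Q*. *)
Definition admissible f : Prop :=
  if f (inr tt) then exists b, forall i, f (inl (inl i)) = b
  else exists b, forall j, f (inl (inr j)) = b.

Lemma starK : involutive (@star p q).
Proof. by case=> u b; rewrite /star /= negbK. Qed.

Lemma in_star_set v S : (v \in star_set S) = (star v \in S).
Proof. by rewrite -{1}[v]starK mem_imset //; exact: inv_inj starK. Qed.

Lemma in_Pset v :
  (v \in Pset p q) = if v.1 is inl (inl _) then ~~ v.2 else false.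
Proof.
apply/imsetP/idP => [[i _ ->] // |].
by case: v => [[[i|j]|[]] []] //= _; exists i.
Qed.

Lemma in_Qset v :
  (v \in Qset p q) = if v.1 is inl (inr _) then ~~ v.2 else false.
Proof.
apply/imsetP/idP => [[i _ ->] // |].
by case: v => [[[i|j]|[]] []] //= _; exists j.
Qed.

Definition inE_vertex := (in_star_set, in_Pset, in_Qset, inE).

(* F_pq^* consists of the four transversals that the conditions P_1 <> {} and
   Q_1 <> {} exclude from E_pq. *)
Lemma QpqFP e :
  reflect (exists2 f, admissible f & e = transversal f)
          (e \in QpqF (star_family (Fpq p q))).
Proof.
(* A set with exactly one vertex of each pair is the transversal of its starred part. *)
have transversal_of (b : bool) S :
    (forall u, ((u, false) \in S) = ((u, true) \notin S)) ->
    ((inr tt, true) \in S) = b ->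
    (if b then exists b', forall i, ((inl (inl i), true) \in S) = b'
     else exists b', forall j, ((inl (inr j), true) \in S) = b') ->
    exists2 f, admissible f & S = transversal f.
  move=> Sstar Sr Sc; exists (fun u => (u, true) \in S).
    by rewrite /admissible Sr.
  by apply/setP => -[u []]; rewrite !inE //= ?Sstar; case: (_ \in S).
have offP (T : {set vertex p q}) : T \subset Pset p q ->
    ((forall u, ((u, true) \in T) = false)
     * (forall u b, ((inl (inr u), b) \in T) = false)
     * (forall u b, ((inr u, b) \in T) = false))%type.
  by move=> /subsetP TP; split=> [|u b]; first split=> [u|u b];
    apply/negP => /TP; rewrite in_Pset //=; case: u => [[]|].
have offQ (T : {set vertex p q}) : T \subset Qset p q ->
    ((forall u, ((u, true) \in T) = false)
     * (forall u b, ((inl (inl u), b) \in T) = false)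
     * (forall u b, ((inr u, b) \in T) = false))%type.
  by move=> /subsetP TQ; split=> [|u b]; first split=> [u|u b];
    apply/negP => /TQ; rewrite in_Qset //=; case: u => [[]|].
apply: (iffP idP) => [|[f f_adm ->]].
  case/setUP => [/setUP[/setUP[/setUP[]|]|]|].
  - case/imsetP=> T /[!inE] /andP[/offP offT _] ->.
    by apply: (transversal_of false) => [[[i|j]|[]]||]; last exists false => ?;
      rewrite !inE_vertex /star /= ?offT ?orbF //=; case: (_ \in T).
  - case/imsetP=> T /[!inE] /andP[/offP offT _] ->.
    by apply: (transversal_of false) => [[[i|j]|[]]||]; last exists true => ?;
      rewrite !inE_vertex /star /= ?offT ?orbF //=; case: (_ \in T).
  - case/imsetP=> T /[!inE] /andP[/offQ offT _] ->.
    by apply: (transversal_of true) => [[[i|j]|[]]||]; last exists false => ?;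
      rewrite !inE_vertex /star /= ?offT ?orbF //=; case: (_ \in T).
  - case/imsetP=> T /[!inE] /andP[/offQ offT _] ->.
    by apply: (transversal_of true) => [[[i|j]|[]]||]; last exists true => ?;
      rewrite !inE_vertex /star /= ?offT ?orbF //=; case: (_ \in T).
  - case/imsetP => S; rewrite !inE -!orbA => /or4P[] /eqP-> ->.
    + by apply: (transversal_of true) => [[[i|j]|[]]||];
        last exists true => ?; rewrite !inE_vertex.
    + by apply: (transversal_of true) => [[[i|j]|[]]||];
        last exists false => ?; rewrite !inE_vertex.
    + by apply: (transversal_of false) => [[[i|j]|[]]||];
        last exists false => ?; rewrite !inE_vertex.
    + by apply: (transversal_of false) => [[[i|j]|[]]||];
        last exists true => ?; rewrite !inE_vertex.
move: f_adm; rewrite /admissible; case fr: (f _) => -[[] fc].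
(* In each of the four cases [T] plays the role of P_1 or Q_1 in the matching family of [Epq]. If it
   is empty, the edge is the star of a member of [Fpq]; here it is P*Q*r*, the star of PQr. *)
- pose T : {set vertex p q} := [set v in Qset p q | ~~ f v.1].
  have [T0|Tn0] := eqVneq T set0.
    have fT i : f (inl (inr i)) = true.
      move/setP/(_ (inl (inr i), false)): T0; rewrite !inE_vertex /=.
      by case: (f _).
    apply/setUP; right; apply/imsetP.
    exists (Pset p q :|: Qset p q :|: [set rvert p q]).
      by rewrite !inE eqxx ?orbT.
    by apply/setP => -[[[i|j]|[]] []]; rewrite !inE_vertex /= ?fT ?fc ?fr.
  apply/setUP; left; apply/setUP; right; apply/imsetP.
  exists T.
    rewrite inE powersetE Tn0 andbT.
    by apply/subsetP => v; rewrite inE => /andP[].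
  by apply/setP => -[[[i|j]|[]] []]; rewrite !inE_vertex /star /= ?fc ?fr //;
    case: (f _).
- pose T : {set vertex p q} := [set v in Qset p q | f v.1].
  have [T0|Tn0] := eqVneq T set0.
    have fT i : f (inl (inr i)) = false.
      move/setP/(_ (inl (inr i), false)): T0; rewrite !inE_vertex /=.
      by case: (f _).
    apply/setUP; right; apply/imsetP.
    exists (star_set (Pset p q) :|: star_set (Qset p q) :|: [set rvert p q]).
      by rewrite !inE eqxx ?orbT.
    by apply/setP => -[[[i|j]|[]] []]; rewrite !inE_vertex /= ?fT ?fc ?fr.
  apply/setUP; left; apply/setUP; left; apply/setUP; right; apply/imsetP.
  exists T.
    rewrite inE powersetE Tn0 andbT.
    by apply/subsetP => v; rewrite inE => /andP[].
  by apply/setP => -[[[i|j]|[]] []]; rewrite !inE_vertex /star /= ?fc ?fr //;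
    case: (f _).
- pose T : {set vertex p q} := [set v in Pset p q | f v.1].
  have [T0|Tn0] := eqVneq T set0.
    have fT i : f (inl (inl i)) = false.
      move/setP/(_ (inl (inl i), false)): T0; rewrite !inE_vertex /=.
      by case: (f _).
    apply/setUP; right; apply/imsetP.
    exists (star_set (Pset p q) :|: Qset p q :|: [set star (rvert p q)]).
      by rewrite !inE eqxx ?orbT.
    by apply/setP => -[[[i|j]|[]] []]; rewrite !inE_vertex /= ?fT ?fc ?fr.
  apply/setUP; left; do 2![apply/setUP; left]; apply/setUP; right; apply/imsetP.
  exists T.
    rewrite inE powersetE Tn0 andbT.
    by apply/subsetP => v; rewrite inE => /andP[].
  by apply/setP => -[[[i|j]|[]] []]; rewrite !inE_vertex /star /= ?fc ?fr //;
    case: (f _).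
- pose T : {set vertex p q} := [set v in Pset p q | ~~ f v.1].
  have [T0|Tn0] := eqVneq T set0.
    have fT i : f (inl (inl i)) = true.
      move/setP/(_ (inl (inl i), false)): T0; rewrite !inE_vertex /=.
      by case: (f _).
    apply/setUP; right; apply/imsetP.
    exists (Pset p q :|: star_set (Qset p q) :|: [set star (rvert p q)]).
      by rewrite !inE eqxx ?orbT.
    by apply/setP => -[[[i|j]|[]] []]; rewrite !inE_vertex /= ?fT ?fc ?fr.
  apply/setUP; left; do 3![apply/setUP; left]; apply/imsetP.
  exists T.
    rewrite inE powersetE Tn0 andbT.
    by apply/subsetP => v; rewrite inE => /andP[].
  by apply/setP => -[[[i|j]|[]] []]; rewrite !inE_vertex /star /= ?fc ?fr //;
    case: (f _).
Qed.

End Transversals.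

(** * Optimal covers and packings *)

Lemma count_threshold (c : bool) x T :
  count (fun k => c == (x <= k)%N) (iota 0 T)
    = if c then (T - x)%N else minn x T.
Proof.
elim: T => [|T IHT]; first by case: c => /=; lia.
by rewrite -addn1 iotaD count_cat IHT /=; case: c {IHT} => /=; lia.
Qed.

Lemma argmin n (F : 'I_n -> nat) :
  (0 < n)%N -> exists i0, forall i, (F i0 <= F i)%N.
Proof.
case: n F => // n F _.
case: (@arg_minnP _ ord0 predT F isT) => i0 _ Fmin.
by exists i0 => i; exact: Fmin.
Qed.

Theorem theorem5p8 (R : archiRealFieldType) (p q : nat)
    (hp : (1 < p)%N) (hq : (1 < q)%N) :
  mengerian R (QpqF (star_family (Fpq p q))).
Proof.
apply: mengerian_nat => W.
pose a i := W (inl (inl i), false); pose a' i := W (inl (inl i), true).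
pose b j := W (inl (inr j), false); pose b' j := W (inl (inr j), true).
pose c := W (inr tt, false); pose c' := W (inr tt, true).
have p_gt0 := ltnW hp; have q_gt0 := ltnW hq.
have [ia aP] := argmin a p_gt0; have [ia' a'P] := argmin a' p_gt0.
have [jb bP] := argmin b q_gt0; have [jb' b'P] := argmin b' q_gt0.
have [iM iMP] := argmin (fun i => a i + a' i)%N p_gt0.
have [jM jMP] := argmin (fun j => b j + b' j)%N q_gt0.
pose n1 := minn c (b jb + b' jb'); pose n2 := minn c' (a ia + a' ia').
pose N := minn (minn (a iM + a' iM) (b jM + b' jM)) (n1 + n2).
(* There will be [t1] edges through r, [alpha] of them containing Q, and [t2 <= n2] edges through
   r*, [beta] of them containing P. *)
pose t1 := minn N n1; pose t2 := (N - t1)%N.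
pose alpha := minn t1 (b jb); pose beta := minn t2 (a ia).
(* Since [beta] edges through r* already use p_i, at most [a i - beta] edges through r may; [x i]
   takes as many as possible. The same holds for [z j]. *)
pose x i := minn t1 (a i - beta)%N; pose z j := minn t2 (b j - alpha)%N.
(* Counting from 0, edge [k] avoids the star exactly below the threshold. The threshold [alpha] does
   not depend on the q-vertex, which makes [f1 k] admissible. *)
pose f1 k (u : 'I_p + 'I_q + unit) := match u with
  | inl (inl i) => (x i <= k)%N | inl (inr _) => (alpha <= k)%N
  | inr _ => false end.
pose f2 k (u : 'I_p + 'I_q + unit) := match u with
  | inl (inl _) => (beta <= k)%N | inl (inr j) => (z j <= k)%N
  | inr _ => true end.
have [C C_cover le_CN] : exists2 C : seq (vertex p q),
    forall f, admissible f -> has (mem (transversal f)) C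
    & (\sum_(v <- C) W v <= N)%N.
  have [le1|lt1] := leqP (a iM + a' iM) N.
    exists [:: (inl (inl iM), false); (inl (inl iM), true)].
      by move=> f _; rewrite /= !inE /=; case: (f _).
    by rewrite !big_cons big_nil addn0.
  have [le2|lt2] := leqP (b jM + b' jM) N.
    exists [:: (inl (inr jM), false); (inl (inr jM), true)].
      by move=> f _; rewrite /= !inE /=; case: (f _).
    by rewrite !big_cons big_nil addn0.
  have -> : N = (n1 + n2)%N by lia.
  (* An edge through r contains q_jb if it contains Q, and the star of q_jb' if it contains Q*, so
     this pair can replace r when it is cheaper; likewise for r*. *)
  exists ((if c <= b jb + b' jb' then [:: (inr tt, false)]
           else [:: (inl (inr jb), false); (inl (inr jb'), true)])
          ++ (if c' <= a ia + a' ia' then [:: (inr tt, true)]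
           else [:: (inl (inl ia), false); (inl (inl ia'), true)]))%N.
    move=> f; rewrite /admissible has_cat.
    case fr: (f _) => -[d fd]; apply/orP; [right | left]; case: ifP => _;
      by rewrite /= !inE /= ?fr ?fd //; case: d {fd}.
  rewrite big_cat /=; apply: leq_add; rewrite /n1 /n2.
    by case: (leqP c) => _; rewrite !big_cons big_nil addn0.
  by case: (leqP c') => _; rewrite !big_cons big_nil addn0.
exists C, ([seq transversal (f1 k) | k <- iota 0 t1]
           ++ [seq transversal (f2 k) | k <- iota 0 t2]); split.
- by move=> e /QpqFP[f f_adm ->]; exact: C_cover.
- move=> e; rewrite mem_cat => /orP[] /mapP[k _ ->]; apply/QpqFP.
    by exists (f1 k) => //; exists (alpha <= k)%N.
  by exists (f2 k) => //; exists (beta <= k)%N.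
- have countE f t v : count (fun e : {set vertex p q} => v \in e)
      [seq transversal (f k) | k <- iota 0 t]
      = count (fun k => v.2 == f k v.1) (iota 0 t).
    by rewrite count_map; apply: eq_count => k; rewrite /= inE.
  case=> -[[i|j]|[]] d; rewrite count_cat !countE /=.
  (* The load of p_i is [x i + beta <= a i], as [beta <= a ia]. The load of its star is
     [t1 - x i + (t2 - beta)]: if [x i = t1], it is at most [a' ia'] because [t2 <= n2]; otherwise
     it is [N - a i <= a' i] by the choice of [iM]. *)
  + rewrite !count_threshold.
    move: (aP i) (a'P i) (iMP i) => /= ? ? ?.
    by rewrite /x; case: d; rewrite -/(a i) -/(a' i); lia.
  + rewrite !count_threshold.
    move: (bP j) (b'P j) (jMP j) => /= ? ? ?.
    by rewrite /z; case: d; rewrite -/(b j) -/(b' j); lia.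
  + case: d; rewrite /= ?count_pred0 ?count_predT size_iota.
      by rewrite -/c'; lia.
    by rewrite -/c; lia.
- rewrite size_cat !size_map !size_iota; apply: leq_trans le_CN _; lia.
Qed.
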